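(* Let $\phi$ be a doubling subharmonic weight on $\mathbb{C}$, let $\rho=\rho_\phi$ be its associated radius function, and let $\Lambda_\phi^P$ be the Poisson process with underlying measure $\sigma_\phi$, where $d\sigma_\phi(z)=\frac{dm(z)}{\rho^2(z)}$. Then $$\mathbb{P}\bigl(\Lambda_\phi^P \text{ is separated}\bigr)=\begin{cases}1 & \text{if } \displaystyle\int_{\mathbb{C}}\frac{dm(z)}{\rho^4(z)}<+\infty,\\[2mm] 0 & \text{if } \displaystyle\int_{\mathbb{C}}\frac{dm(z)}{\rho^4(z)}=+\infty.\end{cases}$$
   Context: $m$ is Lebesgue measure on $\mathbb{C}$ and $D(z,r)$ is the disk with center $z$ and radius $r$. A doubling subharmonic function (weight) is a subharmonic function $\phi$ on $\mathbb{C}$ whose Laplacian $\nu=\Delta\phi$ (a positive measure, taken nonzero) is doubling: there is $C>0$ with $\nu(D(z,2r))\le C\,\nu(D(z,r))$ for all $z\in\mathbb{C}$, $r>0$. For $z\in\mathbb{C}$, $\rho(z)=\rho_\phi(z)$ denotes the positive radius such that $\nu(D(z,\rho(z)))=1$. The Poisson process $\Lambda_\phi^P$ with underlying measure $\sigma_\phi$ is the point process in $\mathbb{C}$ characterized by: (i) for any Borel set $A\subset\mathbb{C}$, the counting variable $N(A)=\#(A\cap\Lambda_\phi^P)$ has Poisson distribution of parameter $\sigma_\phi(A)$; (ii) for disjoint Borel sets the corresponding counting variables are independent. A sequence $\{\lambda_k\}\subset\mathbb{C}$ is separated if $\inf_{j\ne k}|\lambda_k-\lambda_j|>0$. *)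

(* Defs.v *)
From mathcomp Require Import all_boot all_order all_algebra.
From mathcomp Require Import all_classical all_reals all_analysis.
From mathcomp Require Import measurable_realfun.

Set Implicit Arguments.
Unset Strict Implicit.
Unset Printing Implicit Defensive.
Import Order.TTheory GRing.Theory Num.Theory.
Import numFieldNormedType.Exports.

Local Open Scope classical_set_scope.
Local Open Scope ring_scope.

(* The complex plane is identified with R * R, whose
   canonical sigma-algebra is the Borel one. The canonical norm of R * R is the
   sup norm, hence the explicit Euclidean distance; the topology is the same. *)
Notation plane R := (measurableTypeR R * measurableTypeR R)%type.

Definition area {R : realType} : {measure set (plane R) -> \bar R} :=
  (@lebesgue_measure R \x @lebesgue_measure R)%E.

Definition eucl_dist {R : realType} (z w : plane R) : R :=
  Num.sqrt ((z.1 - w.1) ^+ 2 + (z.2 - w.2) ^+ 2).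

Definition disk {R : realType} (z : plane R) (r : R) : set (plane R) :=
  [set w | eucl_dist z w < r].

Definition circle_point {R : realType} (z : plane R) (r t : R) : plane R :=
  (z.1 + r * cos t, z.2 + r * sin t).

Definition subharmonic {R : realType} (phi : plane R -> \bar R) : Prop :=
  [/\ forall z, (phi z < +oo)%E,
      exists z, (-oo < phi z)%E,
      lower_semicontinuous (fun z : R * R => (- phi z)%E) &
      forall (z : plane R) (r : R), 0 < r ->
        (phi z <= ((2 * pi)^-1)%:E *
          \int[lebesgue_measure]_(t in `[0%R, (2 * pi)%R])
            phi (circle_point z r t))%E].

Definition dx {R : realType} (f : R * R -> R) : R * R -> R :=
  fun z => 'D_((1, 0) : R * R) f z.
Definition dy {R : realType} (f : R * R -> R) : R * R -> R :=
  fun z => 'D_((0, 1) : R * R) f z.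

Fixpoint Ck {R : realType} (k : nat) (f : R * R -> R) : Prop :=
  match k with
  | 0 => continuous f
  | k'.+1 => [/\ forall z, differentiable f z, Ck k' (dx f) & Ck k' (dy f)]
  end.

Definition test_function {R : realType} (f : R * R -> R) : Prop :=
  (forall k, Ck k f) /\ compact (closure [set z | f z != 0]).

Definition laplacian {R : realType} (f : R * R -> R) : R * R -> R :=
  fun z => dx (dx f) z + dy (dy f) z.

(* nu is the distributional Laplacian of phi, with no normalizing constant. *)
Definition is_laplacian {R : realType} (phi : plane R -> \bar R)
    (nu : {measure set (plane R) -> \bar R}) : Prop :=
  (forall z r, (nu (disk z r) < +oo)%E) /\
  (forall f : R * R -> R, test_function f ->
     (\int[area]_z (phi z * (laplacian f z)%:E) = \int[nu]_z (f z)%:E)%E).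

Definition doubling {R : realType}
    (nu : {measure set (plane R) -> \bar R}) : Prop :=
  exists2 C : R, 0 < C &
    forall z r, 0 < r -> (nu (disk z (2 * r)) <= C%:E * nu (disk z r))%E.

Definition doubling_weight {R : realType} (phi : plane R -> \bar R)
    (nu : {measure set (plane R) -> \bar R}) : Prop :=
  [/\ subharmonic phi, is_laplacian phi nu, nu setT <> 0%E & doubling nu].

Definition radius_function {R : realType}
    (nu : {measure set (plane R) -> \bar R}) (rho : plane R -> R) : Prop :=
  forall z, 0 < rho z /\ nu (disk z (rho z)) = 1%E.

Definition sigma {R : realType} (rho : plane R -> R) (A : set (plane R)) :
    \bar R :=
  (\int[area]_(z in A) ((rho z ^+ 2)^-1)%:E)%E.

(* A finite or infinite sequence of points, listed with multiplicity; the
   indices sent to None carry no point. *)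
Definition config (R : realType) := nat -> option (plane R).

Definition npoints {R : realType} (s : config R) (A : set (plane R)) : \bar R :=
  counting [set k | exists2 z, s k = Some z & A z].

Definition separated_config {R : realType} (s : config R) : Prop :=
  (0 < ereal_inf [set u : \bar R | exists j k z w,
         [/\ j <> k, s j = Some z, s k = Some w & u = (eucl_dist z w)%:E]])%E.

(* The library's poisson_pmf is identically 1 at rate 0, so it is not used; here
   rate 0 gives the Dirac mass at 0, and rate +oo the Dirac mass at +oo. *)
Definition poisson_distributed {R : realType} {d : measure_display}
    {Omega : measurableType d} (P : probability Omega R)
    (N : Omega -> \bar R) (rate : \bar R) : Prop :=
  match rate with
  | a%:E => forall k : nat,
      P [set w | N w = k%:R%:E] = (a ^+ k / k`!%:R * expR (- a))%:E
  | +oo%E => P [set w | N w = +oo%E] = 1%E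
  | -oo%E => False
  end.

Definition independent_variables {R : realType} {d : measure_display}
    {Omega : measurableType d} (P : probability Omega R) (n : nat)
    (X : 'I_n -> Omega -> \bar R) : Prop :=
  forall B : 'I_n -> set (\bar R), (forall i, measurable (B i)) ->
    P (\bigcap_(i in setT) (X i @^-1` B i)) =
    (\prod_(i < n) P (X i @^-1` B i))%E.

Definition poisson_process {R : realType} {d : measure_display}
    {Omega : measurableType d} (P : probability Omega R)
    (mu : set (plane R) -> \bar R) (Lambda : Omega -> config R) : Prop :=
  [/\ forall A, measurable A ->
        measurable_fun setT (fun w => npoints (Lambda w) A),
      forall A, measurable A ->
        poisson_distributed P (fun w => npoints (Lambda w) A) (mu A) &
      forall (n : nat) (A : 'I_n -> set (plane R)),
        (forall i, measurable (A i)) -> trivIset setT A ->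
        independent_variables P (fun i w => npoints (Lambda w) (A i))].

(* Main.v *)
Require Import Defs.
From mathcomp Require Import all_boot all_order all_algebra.
From mathcomp Require Import all_classical all_reals all_analysis measurable_realfun.
From mathcomp Require Import ring lra.

Set Implicit Arguments.
Unset Strict Implicit.
Unset Printing Implicit Defensive.
Import Order.TTheory GRing.Theory Num.Theory.
Import numFieldNormedType.Exports.

Local Open Scope classical_set_scope.
Local Open Scope ring_scope.

(** A doubling measure charges every disk, so no disk of measure 1 lies inside
    a concentric disk strictly smaller than another disk of measure 1:
    rho is 1-Lipschitz ([radius_function_lipschitz]). The alternative holds for
    every positive 1-Lipschitz rho.

    Cut the plane into squares of side s. A square Q of intensity
    a = sigma Q carries at least two points with probability
    q = 1 - e ^ (- a) (1 + a), which lies between (a / (a + 2)) ^ 2 and a ^ 2.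
    The configuration is separated if and only if, for some s of the form
    2 / (m + 1), each square of the four grids of side s shifted by s / 2
    carries at most one point ([separated_config_sparse]): two points closer
    than s / 2 share a square of one of these grids. This writes separation as a
    countable combination of counting events, whence its measurability.

    If the integral I of rho ^ -4 is finite, Cauchy-Schwarz gives
    a ^ 2 <= s ^ 2 * (integral of rho ^ -4 over Q), and summing over the squares
    of the four grids shows that the configuration fails to be separated with
    probability at most 4 s ^ 2 I, for every such s ([not_atmost1_tile_le]).

    If I is infinite, fix one grid. Its squares are disjoint, so the counting
    variables are independent, and if with positive probability no square
    carried two points, the numbers q would be summable
    ([summable_of_bigcap_atmost1]). Then a tends to 0 along the squares, so rho
    is eventually large compared with s, hence almost constant on each square by
    the Lipschitz property, and the integral of rho ^ -4 over Q is at most a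
    constant times q ([tile_dichotomy]). As rho is bounded below on bounded
    sets, I would be finite. *)

(** * Euclidean geometry of the plane *)

Lemma eucl_distC {R : realType} (z w : plane R) : eucl_dist z w = eucl_dist w z.
Proof. by rewrite /eucl_dist -(sqrrN (z.1 - _)) -(sqrrN (z.2 - _)) !opprB. Qed.

Lemma sqrt_sum_sqrD {R : realType} (a b c d : R) :
  Num.sqrt ((a + c) ^+ 2 + (b + d) ^+ 2) <=
  Num.sqrt (a ^+ 2 + b ^+ 2) + Num.sqrt (c ^+ 2 + d ^+ 2).
Proof.
set u := Num.sqrt (a ^+ 2 + b ^+ 2); set v := Num.sqrt (c ^+ 2 + d ^+ 2).
have u0 : 0 <= u by exact: sqrtr_ge0.
have v0 : 0 <= v by exact: sqrtr_ge0.
have u2 : u ^+ 2 = a ^+ 2 + b ^+ 2 by rewrite sqr_sqrtr ?addr_ge0 ?sqr_ge0.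
have v2 : v ^+ 2 = c ^+ 2 + d ^+ 2 by rewrite sqr_sqrtr ?addr_ge0 ?sqr_ge0.
have cs : a * c + b * d <= u * v.
  apply: (le_trans (ler_norm _)).
  rewrite -ler_sqr ?nnegrE ?mulr_ge0 ?normr_ge0// real_normK ?num_real//.
  rewrite exprMn u2 v2 -subr_ge0.
  have -> : (a ^+ 2 + b ^+ 2) * (c ^+ 2 + d ^+ 2) - (a * c + b * d) ^+ 2 =
    (a * d - b * c) ^+ 2 by ring.
  exact: sqr_ge0.
rewrite -(ler_sqr (x := Num.sqrt _)) ?nnegrE ?addr_ge0 ?sqrtr_ge0//.
rewrite sqr_sqrtr ?addr_ge0 ?sqr_ge0//.
have -> : (u + v) ^+ 2 = u ^+ 2 + v ^+ 2 + 2 * (u * v) by ring.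
rewrite u2 v2; nra.
Qed.

Lemma eucl_dist_triangle {R : realType} (x y z : plane R) :
  eucl_dist x z <= eucl_dist x y + eucl_dist y z.
Proof.
rewrite /eucl_dist.
have -> : x.1 - z.1 = (x.1 - y.1) + (y.1 - z.1) by ring.
have -> : x.2 - z.2 = (x.2 - y.2) + (y.2 - z.2) by ring.
exact: sqrt_sum_sqrD.
Qed.

Lemma eucl_dist_le_norm1 {R : realType} (z w : plane R) :
  eucl_dist z w <= `|z.1 - w.1| + `|z.2 - w.2|.
Proof.
have := sqrt_sum_sqrD (z.1 - w.1) 0 0 (z.2 - w.2).
by rewrite addr0 add0r expr0n/= addr0 add0r !sqrtr_sqr.
Qed.

Lemma norm_fst_le_eucl_dist {R : realType} (z w : plane R) :
  `|z.1 - w.1| <= eucl_dist z w.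
Proof. by rewrite -sqrtr_sqr ler_wsqrtr// lerDl sqr_ge0. Qed.

Lemma norm_snd_le_eucl_dist {R : realType} (z w : plane R) :
  `|z.2 - w.2| <= eucl_dist z w.
Proof. by rewrite -sqrtr_sqr ler_wsqrtr// lerDr sqr_ge0. Qed.

Lemma subset_disk {R : realType} (z w : plane R) (r s : R) :
  r + eucl_dist w z <= s -> disk z r `<=` disk w s.
Proof.
move=> rs x; rewrite /disk /= => zx.
apply: le_lt_trans (eucl_dist_triangle w z x) _.
by rewrite addrC; apply: lt_le_trans rs; rewrite ltrD2r.
Qed.

Lemma bigcup_disk {R : realType} (z : plane R) :
  \bigcup_n disk z n%:R = setT.
Proof.
apply/seteqP; split=> // w _.
exists (Num.bound (eucl_dist z w)) => //; rewrite /disk/=.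
by apply: archi_boundP; exact: sqrtr_ge0.
Qed.

Lemma measurable_eucl_dist {R : realType} (z : plane R) :
  measurable_fun setT (eucl_dist z).
Proof.
apply: measurableT_comp; first exact: continuous_measurable_fun (@sqrt_continuous R).
apply: measurable_funD; apply: measurable_funX; apply: measurable_funB => //.
Qed.

Lemma measurable_disk {R : realType} (z : plane R) (r : R) :
  measurable (disk z r).
Proof.
have -> : disk z r = setT `&` eucl_dist z @^-1` `]-oo, r[.
  by rewrite setTI; apply/seteqP; split=> w /=; rewrite in_itv/=.
by apply: measurable_eucl_dist => //; exact: measurable_itv.
Qed.

(** * The radius function of a doubling measure *)

Section radius.
Context {R : realType} (nu : {measure set (plane R) -> \bar R}).
Hypotheses (nu0 : nu setT <> 0%E) (dnu : doubling nu).

(** A null disk would make all its dilates by powers of 2 null, and these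
    exhaust the plane. *)
Lemma doubling_disk_gt0 (z : plane R) (r : R) : 0 < r -> (0 < nu (disk z r))%E.
Proof.
move=> r0; rewrite lt0e measure_ge0 andbT; apply/eqP => zr0.
have [C C0 hC] := dnu.
have dyadic n : nu (disk z (2 ^+ n * r)) = 0%E.
  elim: n => [|n IH]; first by rewrite expr0 mul1r.
  apply/eqP; rewrite -measure_le0 exprS -mulrA.
  apply: le_trans (hC _ _ _) _; first by rewrite mulr_gt0// exprn_gt0.
  by rewrite IH mule0.
apply: nu0; apply/eqP; rewrite -measure_le0 -(bigcup_disk z).
apply: (@le_trans _ _ (\sum_(n <oo) nu (disk z n%:R))%E).
  apply: measure_sigma_subadditive => [n| |].
  - exact: measurable_disk.
  - by apply: bigcupT_measurable => n; exact: measurable_disk.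
  - by [].
rewrite eseries0// => n _ _; apply/eqP; rewrite -measure_le0.
have [k nk] : exists k, n%:R <= 2 ^+ k * r.
  exists (Num.bound (n%:R / r)).
  rewrite -ler_pdivrMr//; apply: ltW.
  apply: lt_le_trans (archi_boundP _) _; first by rewrite divr_ge0// ltW.
  by rewrite -natrX ler_nat ltnW// ltn_expl.
rewrite -(dyadic k); apply: le_measure; rewrite ?inE; try exact: measurable_disk.
by move=> w; rewrite /disk/= => /lt_le_trans; apply.
Qed.

Context (rho : plane R -> R).
Hypothesis hrho : radius_function nu rho.

(** If rho w exceeded rho z + |z - w|, the annulus between these two radii
    around w would be null, since the smaller disk already contains
    disk z (rho z); but the annulus contains a disk. *)
Lemma radius_function_lipschitz (z w : plane R) :
  rho w <= rho z + eucl_dist z w.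
Proof.
rewrite leNgt; apply/negP => lt_w.
set r := rho z + eucl_dist z w in lt_w *.
pose u : plane R := (w.1 + (rho w + r) / 2, w.2).
pose e := (rho w - r) / 2.
have e0 : 0 < e by rewrite /e divr_gt0// subr_gt0.
have wu : eucl_dist w u = (rho w + r) / 2.
  rewrite /eucl_dist /u/= subrr expr0n/= addr0 opprD addrA subrr add0r sqrrN.
  rewrite sqrtr_sqr ger0_norm// divr_ge0// addr_ge0//.
    by apply: ltW; case: (hrho w).
  by rewrite addr_ge0 ?sqrtr_ge0// ltW//; case: (hrho z).
have sub_u : disk u e `<=` disk w (rho w).
  by apply: subset_disk; rewrite wu /e; lra.
have sub_r : disk w r `<=` disk w (rho w).
  by apply: subset_disk; rewrite /eucl_dist !subrr expr0n/= addr0 sqrtr0; lra.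
have dis : disk w r `&` disk u e = set0.
  apply/seteqP; split=> // x [wx ux].
  have := eucl_dist_triangle w x u; rewrite wu (eucl_distC x).
  by move: wx ux; rewrite /disk/= /e => wx ux; lra.
have le1 : (1 <= nu (disk w r))%E.
  rewrite -(hrho z).2; apply: le_measure; rewrite ?inE; try exact: measurable_disk.
  by apply: subset_disk; rewrite eucl_distC.
have : (nu (disk w r `|` disk u e) <= nu (disk w (rho w)))%E.
  apply: le_measure; rewrite ?inE; try exact: measurable_disk.
    by apply: measurableU; exact: measurable_disk.
  by rewrite subUset.
rewrite measureU//; try exact: measurable_disk.
rewrite (hrho w).2 => le_1.
have := doubling_disk_gt0 u e0; rewrite ltNge => /negP; apply.
have fin_r : nu (disk w r) \is a fin_num.
  rewrite ge0_fin_numE//.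
  by apply: le_lt_trans (leeDl _ _) (le_lt_trans le_1 _); rewrite ?ltry.
rewrite -(@leeD2lE R (nu (disk w r)))// adde0.
exact: le_trans le_1 le1.
Qed.

End radius.

(** * Positive 1-Lipschitz functions on the plane *)

Section positive_lipschitz.
Context {R : realType} (rho : plane R -> R).
Hypothesis rho_gt0 : forall z, 0 < rho z.
Hypothesis rho_lip : forall z w, rho w <= rho z + eucl_dist z w.

(** The disks disk w (c - rho w) with w of rational coordinates exhaust the
    sublevel set of rho at c. *)
Lemma lipschitz_measurable : measurable_fun setT rho.
Proof.
apply: (measurability _ (RGenInftyO.measurableE R)).
move=> _ [_ [c ->] <-]; rewrite setTI.
pose q (ij : rat * rat) : plane R := (ratr ij.1, ratr ij.2).
have -> : rho @^-1` `]-oo, c[ = \bigcup_ij disk (q ij) (c - rho (q ij)).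
  apply/seteqP; split=> [z|z [ij _]] /=; rewrite ?in_itv/=; last first.
    rewrite /disk/= => zw; have := rho_lip (q ij) z; lra.
  move=> zc; pose e := (c - rho z) / 4.
  have e0 : 0 < e by rewrite /e divr_gt0// subr_gt0.
  have rat_near (x : R) : exists i : rat, `|x - ratr i| < e.
    have [i] : exists i : rat, ratr i \in `]x - e, x + e[.
      by apply: rat_in_itvoo; lra.
    by rewrite in_itv/= => /andP[i1 i2]; exists i; rewrite ltr_norml; lra.
  have [[i hi] [j hj]] := (rat_near z.1, rat_near z.2).
  exists (i, j) => //; rewrite /disk/=.
  have := eucl_dist_le_norm1 z (q (i, j)) => /=.
  have := rho_lip z (q (i, j)).
  rewrite (eucl_distC (q _)) /e in hi hj *; lra.
apply: countable_bigcupT_measurable; last by move=> ij; exact: measurable_disk.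
exact: countableP.
Qed.

Lemma lipschitz_continuous : continuous (rho : R * R -> R).
Proof.
move=> z; apply/cvgrPdist_lt => e e0.
have e20 : 0 < e / 2 by rewrite divr_gt0.
near=> w.
have wz : `|z.1 - w.1| < e / 2 /\ `|z.2 - w.2| < e / 2.
  near: w; exists (ball z.1 (e / 2), ball z.2 (e / 2)) => //=.
  by split; exact: nbhsx_ballx.
have := rho_lip z w; have := rho_lip w z.
have := eucl_dist_le_norm1 z w; rewrite (eucl_distC w) ltr_norml.
case: wz; lra.
Unshelve. all: by end_near. Qed.

Lemma lipschitz_box_lbound (a b c d : R) : a <= b -> c <= d ->
  exists2 l, 0 < l &
    forall z, z.1 \in `[a, b] -> z.2 \in `[c, d] -> l <= rho z.
Proof.
move=> ab cd.
have [] := @compact_EVT_min (R * R)%type R rho (`[a, b] `*` `[c, d]).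
- by exists (a, c); split; rewrite /= in_itv/= lexx.
- by apply: compact_setX; exact: segment_compact.
- by apply: continuous_subspaceT; exact: lipschitz_continuous.
move=> z _ zmin; exists (rho z); first exact: rho_gt0.
by move=> w w1 w2; apply: zmin; rewrite inE.
Qed.

End positive_lipschitz.

Lemma area_setX {R : realType} (A B : set (measurableTypeR R)) :
  measurable A -> measurable B ->
  area (A `*` B) = (@lebesgue_measure R A * @lebesgue_measure R B)%E.
Proof.
move=> mA mB.
exact: (@product_measure1E _ _ _ _ R (@lebesgue_measure R)
          (@lebesgue_measure R) A B mA mB).
Qed.

(** * Tilings of the plane by half-open squares *)

Definition tile_side {R : realType} (s t : R) (i : int) : set R :=
  `[t + i%:~R * s, t + (i + 1)%:~R * s[.

(** The squares of side s of the grid through t, enumerated along the bijection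
    of int * int with a subset of nat; the remaining indices give set0. *)
Definition tile {R : realType} (s : R) (t : R * R) (n : nat) : set (plane R) :=
  if choice.pickle_inv n is Some ij then
    tile_side s t.1 ij.1 `*` tile_side s t.2 ij.2
  else set0.

Section tiles.
Context {R : realType} (s : R) (s0 : 0 < s).

Lemma tile_sideE (t x : R) (i : int) :
  tile_side s t i x <-> i = Num.floor ((x - t) / s).
Proof.
rewrite /tile_side /= in_itv/=; split=> [/andP[h1 h2]|->].
  apply/esym/eqP; rewrite floor_eq ler_pdivlMr// ltr_pdivrMr//.
  by apply/andP; split; lra.
have /andP[] := floor_itv ((x - t) / s).
by rewrite ler_pdivlMr// ltr_pdivrMr// => h1 h2; apply/andP; split; lra.
Qed.

Lemma tile_side_diam (t x y : R) (i : int) :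
  tile_side s t i x -> tile_side s t i y -> `|x - y| <= s.
Proof.
rewrite /tile_side /= !in_itv/= => /andP[x1 x2] /andP[y1 y2].
by move: x2 y2; rewrite intrD mulrDl mul1r ler_norml => x2 y2; lra.
Qed.

Lemma lebesgue_measure_tile_side (t : R) (i : int) :
  lebesgue_measure (tile_side s t i) = s%:E.
Proof.
rewrite /tile_side lebesgue_measure_itv/= lte_fin intrD.
rewrite ifT ?ltrD2l ?ltr_pM2r ?ltrDl// -EFinD; congr (_%:E); ring.
Qed.

Lemma tile_pickle (t : R * R) (ij : int * int) :
  tile s t (choice.pickle ij) = tile_side s t.1 ij.1 `*` tile_side s t.2 ij.2.
Proof. by rewrite /tile choice.pickleK_inv. Qed.

Lemma tileP (t : R * R) n : tile s t n = set0 \/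
  exists2 ij : int * int, choice.pickle ij = n &
    tile s t n = tile_side s t.1 ij.1 `*` tile_side s t.2 ij.2.
Proof.
rewrite /tile; case E: choice.pickle_inv => [ij|]; [right|by left].
by exists ij => //; have := choice.pickle_invK (T := (int * int)%type) n; rewrite E.
Qed.

Lemma measurable_tile t n : measurable (tile s t n).
Proof.
have [->//|[ij _ ->]] := tileP t n.
by apply: measurableX; exact: measurable_itv.
Qed.

Lemma trivIset_tile t : trivIset setT (tile s t).
Proof.
move=> m n _ _ [z []].
have [->//|[ij <- ->]] := tileP t m; have [->//|[kl <- ->]] := tileP t n.
move=> [/= /tile_sideE e1 /tile_sideE e2] [/tile_sideE e3 /tile_sideE e4].
by congr choice.pickle; rewrite (surjective_pairing ij) e1 e2 -e3 -e4 -surjective_pairing.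
Qed.

Lemma bigcup_tile t : \bigcup_n tile s t n = setT.
Proof.
apply/seteqP; split=> // z _.
have [i iz] : exists i, tile_side s t.1 i z.1.
  by eexists; apply/tile_sideE.
have [j jz] : exists j, tile_side s t.2 j z.2.
  by eexists; apply/tile_sideE.
by exists (choice.pickle (i, j)); [|rewrite tile_pickle].
Qed.

Lemma area_tile t n : tile s t n = set0 \/ area (tile s t n) = (s ^+ 2)%:E.
Proof.
have [->|[ij _ ->]] := tileP t n; [by left|right].
rewrite area_setX; [|exact: measurable_itv..].
by rewrite !lebesgue_measure_tile_side.
Qed.

Lemma tile_diam t n z w : tile s t n z -> tile s t n w -> eucl_dist z w <= 2 * s.
Proof.
have [->//|[ij _ ->]] := tileP t n.
move=> [z1 z2] [w1 w2]; apply: le_trans (eucl_dist_le_norm1 z w) _.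
by rewrite mulr_natl mulr2n lerD// ?(tile_side_diam z1 w1) ?(tile_side_diam z2 w2).
Qed.

Lemma tile_bounded t n : exists a b c d, [/\ a <= b, c <= d &
  forall z, tile s t n z -> z.1 \in `[a, b] /\ z.2 \in `[c, d]].
Proof.
have [->|[ij _ ->]] := tileP t n; first by exists 0, 0, 0, 0.
exists (t.1 + ij.1%:~R * s), (t.1 + (ij.1 + 1)%:~R * s).
exists (t.2 + ij.2%:~R * s), (t.2 + (ij.2 + 1)%:~R * s).
have le_end (u : R) (i : int) : u + i%:~R * s <= u + (i + 1)%:~R * s.
  by rewrite intrD mulrDl mul1r addrA lerDl ltW.
split=> //.
move=> z [] /=; rewrite /tile_side /= !in_itv/=.
by move=> /andP[-> /ltW ->] /andP[-> /ltW ->].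
Qed.

End tiles.

Definition tile_offset {R : realType} (h : R) (b : bool * bool) : R * R :=
  (if b.1 then h else 0, if b.2 then h else 0).

(** Two reals at distance less than h that are separated by a point of the grid
    2 h Z are not separated by a point of h + 2 h Z. *)
Lemma common_tile_side {R : realType} (h x y : R) : `|x - y| < h ->
  exists (b : bool) (i : int),
    tile_side (2 * h) (if b then h else 0) i x /\
    tile_side (2 * h) (if b then h else 0) i y.
Proof.
wlog xy : x y / x <= y.
  move=> H; have [/H//|/ltW/H] := leP x y.
  by rewrite distrC => h1 /h1[b [i [? ?]]]; exists b, i.
rewrite ler0_norm ?subr_le0// => xyh.
have h0 : 0 < 2 * h by lra.
pose i := Num.floor (x / (2 * h)).
have /andP[] := floor_itv (x / (2 * h)).
rewrite ler_pdivlMr// ltr_pdivrMr// -/i intrD mulrDl mul1r => i1 i2.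
have [y2|y2] := ltP y (i%:~R * (2 * h) + 2 * h).
  exists false, i; rewrite /tile_side /= !in_itv/= intrD mulrDl mul1r.
  by split; apply/andP; split; lra.
exists true, i; rewrite /tile_side /= !in_itv/= intrD mulrDl mul1r.
by split; apply/andP; split; lra.
Qed.

Lemma common_tile {R : realType} (h : R) (z w : plane R) : eucl_dist z w < h ->
  exists b n, tile (2 * h) (tile_offset h b) n z /\
              tile (2 * h) (tile_offset h b) n w.
Proof.
move=> zw.
have [b1 [i [z1 w1]]] := common_tile_side (le_lt_trans (norm_fst_le_eucl_dist z w) zw).
have [b2 [j [z2 w2]]] := common_tile_side (le_lt_trans (norm_snd_le_eucl_dist z w) zw).
by exists (b1, b2), (choice.pickle (i, j)); rewrite tile_pickle.
Qed.

(** * Separation in terms of counting variables *)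

Lemma npoints_nat_or_pinfty {R : realType} (s : config R) A :
  npoints s A = +oo%E \/ exists k : nat, npoints s A = k%:R%:E.
Proof.
rewrite /npoints /counting; case: ifPn => _; last by left.
by right; eexists.
Qed.

Lemma npoints_le1P {R : realType} (s : config R) A :
  (npoints s A <= 1)%E <->
  forall j k z w, s j = Some z -> s k = Some w -> A z -> A w -> j = k.
Proof.
rewrite /npoints; set X := [set k | _]; split.
  move=> X1 j k z w sj sk Az Aw; apply/eqP/negPn/negP => jk.
  have : (counting [set j; k] <= counting X :> \bar R)%E.
    apply: le_measure; rewrite ?inE//.
    by move=> _ [->|->]; [exists z|exists w].
  have c1 (i : nat) : counting [set i] = 1%E :> \bar R.
    by rewrite /counting asboolT// fset_set1 finmap.cardfs1.
  have -> : counting [set j; k] = (1 + 1)%E :> \bar R.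
    rewrite -{1}(c1 j) -(c1 k); apply: (measureU counting) => //.
    by apply/seteqP; split=> // i [-> kj]; move: jk; rewrite kj eqxx.
  by move=> /le_trans/(_ X1); rewrite lee_fin gerDl ler10.
move=> inj.
have [->|/set0P[j Xj]] := eqVneq X set0; first by rewrite measure0.
have -> : X = [set j].
  case: Xj => z sj Az; apply/seteqP; split=> [k [w sk Aw]|_ ->]; last by exists z.
  exact: inj sk sj Aw Az.
by rewrite /counting asboolT// fset_set1 finmap.cardfs1.
Qed.

Lemma separated_configP {R : realType} (s : config R) :
  separated_config s <->
  exists m : nat, forall j k z w, j <> k -> s j = Some z -> s k = Some w ->
    m.+1%:R^-1 <= eucl_dist z w.
Proof.
rewrite /separated_config; set U := [set u | _]; split=> [inf0|[m hm]]; last first.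
  apply: (@lt_le_trans _ _ (m.+1%:R^-1)%:E); first by rewrite lte_fin invr_gt0.
  apply: le_ereal_inf_tmp => _ [j [k [z [w [jk sj sk ->]]]]].
  by rewrite lee_fin; exact: hm sj sk.
have [r r0 rinf] : exists2 r : R, 0 < r & (r%:E <= ereal_inf U)%E.
  case: (ereal_inf U) inf0 => [r|_|//]; first by rewrite lte_fin => r0; exists r.
  by exists 1; rewrite ?leey.
exists (Num.bound r^-1) => j k z w jk sj sk.
have rzw : r <= eucl_dist z w.
  rewrite -lee_fin; apply: le_trans rinf _; apply: ereal_inf_lbound.
  by exists j, k, z, w.
apply: le_trans rzw; rewrite -[leRHS]invrK lef_pV2 ?posrE ?invr_gt0//.
apply: ltW; apply: lt_trans (archi_boundP _) _; first by rewrite invr_ge0 ltW.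
by rewrite ltr_nat.
Qed.

(** The configurations having at most one point in each square of side 2 h of
    the four grids shifted by h. *)
Definition sparse_config {R : realType} (h : R) (s : config R) : Prop :=
  forall b n, (npoints s (tile (2 * h) (tile_offset h b) n) <= 1)%E.

Lemma separated_config_sparse {R : realType} (s : config R) :
  separated_config s <-> exists m : nat, sparse_config (m.+1%:R^-1) s.
Proof.
split=> [/separated_configP[m hm]|[m hm]]; last first.
  apply/separated_configP; exists m => j k z w jk sj sk.
  rewrite leNgt; apply/negP => /common_tile[b [n [zn wn]]]; apply: jk.
  by have /npoints_le1P := hm b n; apply; eassumption.
(* a square of side 2 / (5 (m + 1)) has diameter less than 1 / (m + 1) *)
exists (5 * m.+1).-1 => b n; rewrite prednK ?muln_gt0//.
set h := (5 * m.+1)%:R^-1.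
have h0 : 0 < h by rewrite invr_gt0 ltr0n muln_gt0.
apply/npoints_le1P => j k z w sj sk zn wn; apply: contrapT => jk.
have := hm j k z w jk sj sk.
have -> : m.+1%:R^-1 = 5 * h :> R.
  by rewrite /h natrM invfM mulrA mulfV ?mul1r// pnatr_eq0.
have := tile_diam zn wn; lra.
Qed.

(** * Poisson variables *)

(** The probability that a Poisson variable of rate a is at least 2. *)
Definition poisson_gt1 {R : realType} (a : R) : R := 1 - expR (- a) * (1 + a).

Section poisson_bounds.
Context {R : realType}.
Implicit Type a : R.

Lemma poisson_gt1_le a : 0 <= a -> poisson_gt1 a <= a ^+ 2.
Proof. by move=> a0; have := expR_ge1Dx (- a); rewrite /poisson_gt1; nra. Qed.

(** This is 1 + a / 2 <= e ^ (a / 2), squared. *)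
Lemma poisson_gt1_ge a : 0 <= a -> (a / (a + 2)) ^+ 2 <= poisson_gt1 a.
Proof.
move=> a0; set u := expR (- (a / 2)).
have u0 : 0 <= u by exact: expR_ge0.
have ua : u * (1 + a / 2) <= 1.
  rewrite -[leRHS](expRxMexpNx_1 (a / 2)) mulrC ler_wpM2r//.
  exact: expR_ge1Dx.
have uE : expR (- a) = u ^+ 2.
  by rewrite /u expr2 -expRD; congr expR; field.
have ua2 : u * (a + 2) / 2 <= 1 by rewrite (_ : _ / 2 = u * (1 + a / 2)) //; field.
have sqr1 : (u * (a + 2) / 2) ^+ 2 <= 1.
  by rewrite expr_le1// divr_ge0// mulr_ge0// addr_ge0.
rewrite /poisson_gt1 uE.
have -> : (a / (a + 2)) ^+ 2 = 1 - (1 + a) * (2 / (a + 2)) ^+ 2.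
  by field; lra.
have : u ^+ 2 <= (2 / (a + 2)) ^+ 2.
  rewrite (_ : u ^+ 2 = (u * (a + 2) / 2) ^+ 2 * (2 / (a + 2)) ^+ 2).
    by rewrite ler_piMl// sqr_ge0.
  by field; lra.
nra.
Qed.

Lemma poisson_gt1_ge0 a : 0 <= a -> 0 <= poisson_gt1 a.
Proof. by move=> /poisson_gt1_ge; apply: le_trans; exact: sqr_ge0. Qed.

Lemma poisson_gt1_le1 a : 0 <= a -> poisson_gt1 a <= 1.
Proof. by move=> a0; rewrite gerBl mulr_ge0 ?expR_ge0// addr_ge0. Qed.

End poisson_bounds.

Section poisson_process_lemmas.
Context {R : realType} {d : measure_display} {Omega : measurableType d}.
Context (P : probability Omega R).
Context (mu : set (plane R) -> \bar R) (Lambda : Omega -> config R).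
Hypothesis hL : poisson_process P mu Lambda.

Definition atmost1 (A : set (plane R)) : set Omega :=
  [set w | (npoints (Lambda w) A <= 1)%E].

Lemma measurable_atmost1 A : measurable A -> measurable (atmost1 A).
Proof.
case: hL => mN _ _ mA.
have -> : atmost1 A =
    setT `&` (fun w => npoints (Lambda w) A) @^-1` `]-oo, 1%E].
  by rewrite setTI; apply/seteqP; split=> w /=; rewrite in_itv.
by apply: mN => //; exact: emeasurable_itv.
Qed.

Lemma probability_atmost1 A a : measurable A -> mu A = a%:E ->
  P (atmost1 A) = (1 - poisson_gt1 a)%:E.
Proof.
case: hL => mN dN _ mA muA; have := dN A mA; rewrite muA /= => dNA.
have mk (k : nat) : measurable [set w | npoints (Lambda w) A = k%:R%:E].
  rewrite -[X in measurable X]setTI.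
  exact: (mN A mA measurableT [set k%:R%:E] (emeasurable_set1 _)).
have -> : atmost1 A = [set w | npoints (Lambda w) A = 0%:R%:E] `|`
                      [set w | npoints (Lambda w) A = 1%:R%:E].
  apply/seteqP; split=> w; rewrite /atmost1 /=; last first.
    by case=> ->; rewrite lee_fin lern1.
  have [->//|[k ->]] := npoints_nat_or_pinfty (Lambda w) A.
  by rewrite lee_fin lern1; case: k => [|[|//]]; [left|right].
transitivity (P [set w | npoints (Lambda w) A = 0%:R%:E] +
              P [set w | npoints (Lambda w) A = 1%:R%:E])%E.
  apply: measureU => //.
  by apply/seteqP; split=> // w [/= ->] [] /eqP; rewrite eq_sym oner_eq0.
rewrite !dNA -EFinD; congr (_%:E).
by rewrite /poisson_gt1 expr0 expr1 fact0 (_ : 1`!%N = 1%N)// !divr1; ring.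
Qed.

Lemma probability_not_atmost1 A a : measurable A -> mu A = a%:E ->
  P (~` atmost1 A) = (poisson_gt1 a)%:E.
Proof.
move=> mA muA; rewrite probability_setC; last exact: measurable_atmost1.
by rewrite (probability_atmost1 mA muA) -EFinB opprB addrC subrK.
Qed.

Lemma probability_bigcup_not_atmost1 (F : nat -> set (plane R)) (a : nat -> R) :
  (forall n, measurable (F n)) -> (forall n, mu (F n) = (a n)%:E) ->
  (forall n, 0 <= a n) ->
  (P (\bigcup_n ~` atmost1 (F n)) <= \sum_(n <oo) (a n ^+ 2)%:E)%E.
Proof.
move=> mF muF a0.
apply: (@le_trans _ _ (\sum_(n <oo) P (~` atmost1 (F n)))%E).
  have mC n : measurable (~` atmost1 (F n)).
    by apply: measurableC; exact: measurable_atmost1.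
  by apply: measure_sigma_subadditive => //; exact: bigcupT_measurable.
apply: lee_nneseries => // n _.
by rewrite (probability_not_atmost1 (mF n) (muF n)) lee_fin poisson_gt1_le.
Qed.

(** By independence, the probability of the intersection is at most each partial
    product of the factors 1 - q n <= e ^ (- q n), where q n = poisson_gt1 (a n);
    its logarithm therefore bounds the partial sums of q. *)
Lemma summable_of_bigcap_atmost1 (F : nat -> set (plane R)) (a : nat -> R) :
  (forall n, measurable (F n)) -> trivIset setT F ->
  (forall n, mu (F n) = (a n)%:E) -> (forall n, 0 <= a n) ->
  (0 < P (\bigcap_n atmost1 (F n)))%E ->
  (\sum_(n <oo) (poisson_gt1 (a n))%:E < +oo)%E.
Proof.
move=> mF tF muF a0 P0.
have mI : measurable (\bigcap_n atmost1 (F n)).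
  by apply: bigcapT_measurable => n; exact: measurable_atmost1.
have finP := fin_num_measure P _ mI.
set e := fine (P (\bigcap_n atmost1 (F n))).
have e0 : 0 < e by rewrite fine_gt0// P0 ltey_eq finP.
have le_exp n : e <= expR (- \sum_(i < n) poisson_gt1 (a i)).
  rewrite -lee_fin fineK//.
  apply: (@le_trans _ _ (P (\bigcap_(i in @setT 'I_n) atmost1 (F i)))).
    apply: le_measure; rewrite ?inE//.
      apply: fin_bigcap_measurable => [|i _]; first exact: finite_finset.
      exact: measurable_atmost1.
    by move=> w h i _; exact: h.
  have [_ _ indep] := hL.
  have tFn : trivIset setT (fun i : 'I_n => F i).
    by move=> i j _ _ /(tF _ _ I I) ij; exact: val_inj.
  have := indep n (fun i => F i) (fun i => mF i) tFn (fun=> `]-oo, 1%E]%classic)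
    (fun=> emeasurable_itv _).
  have E A : (fun w => npoints (Lambda w) A) @^-1` `]-oo, 1%E] = atmost1 A.
    by apply/seteqP; split=> w /=; rewrite in_itv.
  under eq_bigcapr do rewrite E.
  move=> ->; under eq_bigr do rewrite E (probability_atmost1 (mF _) (muF _)).
  rewrite prodEFin lee_fin -sumrN expR_sum; apply: ler_prod => i _.
  by rewrite subr_ge0 poisson_gt1_le1//=; exact: expR_ge1Dx.
apply: (@le_lt_trans _ _ (- ln e)%:E); last exact: ltry.
apply: lime_le.
  by apply: is_cvg_nneseries => n _ _; rewrite lee_fin poisson_gt1_ge0.
apply: nearW => n; rewrite sumEFin lee_fin big_mkord lerNr.
by rewrite -[leRHS]expRK ler_ln ?posrE ?expR_gt0.
Qed.

End poisson_process_lemmas.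

(** * Integral bounds *)

Section integral_bounds.
Context {R : realType} {d : measure_display} {T : measurableType d}.
Context (mu : {measure set T -> \bar R}) (A : set T) (mA : measurable A).
Context (f : T -> R) (mf : measurable_fun A f) (f0 : forall x, A x -> 0 <= f x).

(** Cauchy-Schwarz against the constant 1, from the integration over A of
    2 u f <= u ^ 2 + f ^ 2 with u = a / c. *)
Lemma sqr_integral_le (c : R) : 0 < c -> (mu A <= c%:E)%E ->
  (\int[mu]_(x in A) (f x ^+ 2)%:E < +oo)%E ->
  exists a, [/\ 0 <= a, (\int[mu]_(x in A) (f x)%:E = a%:E)%E &
    ((a ^+ 2)%:E <= c%:E * \int[mu]_(x in A) (f x ^+ 2)%:E)%E].
Proof.
move=> c0 muA f2oo.
have mf1 : measurable_fun A (EFin \o f) by exact: measurableT_comp.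
have mf2 : measurable_fun A (fun x => (f x ^+ 2)%:E).
  by apply/measurable_EFinP; exact: measurable_funX.
have f20 : (0 <= \int[mu]_(x in A) (f x ^+ 2)%:E)%E.
  by apply: integral_ge0 => x _; rewrite lee_fin sqr_ge0.
have [b bE] : exists b, (\int[mu]_(x in A) (f x ^+ 2)%:E = b%:E)%E.
  exists (fine (\int[mu]_(x in A) (f x ^+ 2)%:E)%E).
  by rewrite fineK// ge0_fin_numE.
have young (u : R) : 0 <= u ->
    ((2 * u)%:E * \int[mu]_(x in A) (f x)%:E <= (u ^+ 2 * c + b)%:E)%E.
  move=> u0; rewrite -ge0_integralZl_EFin ?mulr_ge0//.
  apply: (@le_trans _ _ (\int[mu]_(x in A) ((u ^+ 2)%:E + (f x ^+ 2)%:E))%E).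
    apply: ge0_le_integral => //.
    - by move=> x Ax; rewrite -EFinM lee_fin mulr_ge0 ?mulr_ge0// f0.
    - by apply/measurable_EFinP; apply: measurable_funM.
    - by apply/measurable_EFinP; apply: measurable_funD => //; exact: measurable_funX.
    move=> x Ax; rewrite -EFinM -EFinD lee_fin -subr_ge0.
    have -> : u ^+ 2 + f x ^+ 2 - 2 * u * f x = (u - f x) ^+ 2 by ring.
    exact: sqr_ge0.
  rewrite ge0_integralD//; try by move=> x _; rewrite lee_fin sqr_ge0.
  rewrite integral_cst// bE EFinD leeD2r// (EFinM (u ^+ 2) c).
  by apply: lee_wpmul2l; rewrite ?lee_fin ?sqr_ge0.
have I0 : (0 <= \int[mu]_(x in A) (f x)%:E)%E.
  by apply: integral_ge0 => x Ax; rewrite lee_fin f0.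
have [a aE] : exists a, (\int[mu]_(x in A) (f x)%:E = a%:E)%E.
  exists (fine (\int[mu]_(x in A) (f x)%:E)%E); rewrite fineK// ge0_fin_numE//.
  have h : (0 <= 2^-1 :> R) by rewrite invr_ge0.
  by have := young _ h; rewrite mulfV ?pnatr_eq0// mul1e => /le_lt_trans; apply; exact: ltry.
have a0 : 0 <= a by rewrite -lee_fin -aE.
exists a; split=> //; rewrite bE -EFinM lee_fin.
have ac0 : 0 <= a / c by rewrite divr_ge0// ltW.
have := young _ ac0; rewrite aE -EFinM lee_fin.
have -> : 2 * (a / c) * a = 2 * (a ^+ 2 / c) by ring.
have -> : (a / c) ^+ 2 * c = a ^+ 2 / c by field; rewrite gt_eqF.
move=> le_b; rewrite mulrC -ler_pdivrMr//; lra.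
Qed.

Lemma integral_between (c lo hi : R) : mu A = c%:E -> 0 <= hi ->
  (forall x, A x -> f x <= hi) -> (forall x, A x -> lo <= f x) -> 0 <= lo ->
  exists2 a, (\int[mu]_(x in A) (f x)%:E = a%:E)%E & lo * c <= a <= hi * c.
Proof.
move=> muA hi0 fhi flo lo0.
have I0 : (0 <= \int[mu]_(x in A) (f x)%:E)%E.
  by apply: integral_ge0 => x Ax; rewrite lee_fin f0.
have mf1 : measurable_fun A (EFin \o f) by exact: measurableT_comp.
have Ihi : (\int[mu]_(x in A) (f x)%:E <= (hi * c)%:E)%E.
  rewrite EFinM -muA -integral_cst//; exact: ge0_le_integral.
have Ilo : ((lo * c)%:E <= \int[mu]_(x in A) (f x)%:E)%E.
  rewrite EFinM -muA -integral_cst//; exact: ge0_le_integral.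
exists (fine (\int[mu]_(x in A) (f x)%:E)%E).
  by rewrite fineK// ge0_fin_numE//; apply: le_lt_trans Ihi _; exact: ltry.
rewrite -!lee_fin fineK ?Ilo//.
by rewrite ge0_fin_numE//; apply: le_lt_trans Ihi _; exact: ltry.
Qed.

End integral_bounds.

(** * The zero-one alternative for a positive 1-Lipschitz radius *)

Section separation.
Context {R : realType} {d : measure_display} {Omega : measurableType d}.
Context (P : probability Omega R) (rho : plane R -> R) (Lambda : Omega -> config R).
Hypothesis rho_gt0 : forall z, 0 < rho z.
Hypothesis rho_lip : forall z w, rho w <= rho z + eucl_dist z w.
Hypothesis hL : poisson_process P (sigma rho) Lambda.

Let mrhoV n : measurable_fun setT (fun z => (rho z ^+ n)^-1).
Proof.
have -> : (fun z => (rho z ^+ n)^-1) = (fun z => powR (rho z ^+ n) (-1)).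
  by apply/funext => z; rewrite powR_inv1// exprn_ge0// ltW.
apply: (@measurableT_comp _ _ _ _ _ _ (fun x : R => powR x (-1)) _
  (fun z => rho z ^+ n)); first exact: measurable_powR.
by apply: measurable_funX; exact: lipschitz_measurable.
Qed.

Let rhoV_ge0 n z : 0 <= (rho z ^+ n)^-1.
Proof. by rewrite invr_ge0 exprn_ge0// ltW. Qed.

Let rhoV4E z : (rho z ^+ 4)^-1 = ((rho z ^+ 2)^-1) ^+ 2.
Proof. by rewrite exprVn -exprM. Qed.

Let sparse (h : R) : set Omega := [set w | sparse_config h (Lambda w)].

Let sparseE h : sparse h =
  \bigcap_b \bigcap_n atmost1 Lambda (tile (2 * h) (tile_offset h b) n).
Proof. by apply/seteqP; split=> w /= H b; [move=> _ n _|move=> n]; exact: H. Qed.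

Let measurable_sparse h : measurable (sparse h).
Proof.
rewrite sparseE; apply: fin_bigcap_measurable => [|b _]; first exact: finite_finset.
apply: bigcapT_measurable => n; apply: (measurable_atmost1 hL).
exact: measurable_tile.
Qed.

Let separatedE : [set w | separated_config (Lambda w)] =
  \bigcup_m sparse (m.+1%:R^-1).
Proof.
apply/seteqP; split=> w /=.
  by move=> /separated_config_sparse[m hm]; exists m.
by move=> [m _ hm]; apply/separated_config_sparse; exists m.
Qed.

Lemma measurable_separated : measurable [set w | separated_config (Lambda w)].
Proof. by rewrite separatedE; exact: bigcupT_measurable. Qed.

Let integral_tiles (s : R) t : 0 < s ->
  (\int[area]_z ((rho z ^+ 4)^-1)%:E =
   \sum_(n <oo) \int[area]_(z in tile s t n) ((rho z ^+ 4)^-1)%:E)%E.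
Proof.
move=> s0; rewrite -[in LHS](bigcup_tile s0 t) ge0_integral_bigcup //.
- by move=> n; exact: measurable_tile.
- by apply/measurable_EFinP; apply: measurable_funTS; exact: mrhoV.
- by move=> z _; rewrite lee_fin rhoV_ge0.
- exact: trivIset_tile.
Qed.

(** Summing Cauchy-Schwarz over the squares of one grid bounds the sum of
    sigma ^ 2 by the area of a square times the integral of rho ^ -4. *)
Lemma not_atmost1_tile_le (s : R) t : 0 < s ->
  (\int[area]_z ((rho z ^+ 4)^-1)%:E < +oo)%E ->
  (P (\bigcup_n ~` atmost1 Lambda (tile s t n)) <=
     (s ^+ 2)%:E * \int[area]_z ((rho z ^+ 4)^-1)%:E)%E.
Proof.
move=> s0 Ioo.
have cs n : exists a, [/\ 0 <= a, sigma rho (tile s t n) = a%:E &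
    ((a ^+ 2)%:E <=
      (s ^+ 2)%:E * \int[area]_(z in tile s t n) ((rho z ^+ 4)^-1)%:E)%E].
  have mT := measurable_tile s t n.
  have mf : measurable_fun (tile s t n) (fun z => (rho z ^+ 2)^-1).
    exact: measurable_funTS (mrhoV 2).
  have s20 : 0 < s ^+ 2 by rewrite exprn_gt0.
  have areaT : (area (tile s t n) <= (s ^+ 2)%:E)%E.
    by have [->|->//] := area_tile s0 t n; rewrite measure0 lee_fin ltW.
  have f2oo : (\int[area]_(z in tile s t n) (((rho z ^+ 2)^-1) ^+ 2)%:E < +oo)%E.
    apply: le_lt_trans Ioo; under eq_integral do rewrite -rhoV4E.
    apply: ge0_subset_integral => //.
      by apply/measurable_EFinP; exact: mrhoV.
    by move=> z _; rewrite lee_fin rhoV_ge0.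
  have [a [a0 aE a2]] :=
    sqr_integral_le mT mf (fun z _ => rhoV_ge0 2 z) s20 areaT f2oo.
  exists a; split=> //; move: a2; congr (_ <= _ * _)%E.
  by apply: eq_integral => z _; rewrite rhoV4E.
have [a ha] := choice cs.
apply: (@le_trans _ _ (\sum_(n <oo) (a n ^+ 2)%:E)%E).
  apply: (probability_bigcup_not_atmost1 hL) => n; first exact: measurable_tile.
  - by case: (ha n).
  - by case: (ha n).
rewrite (integral_tiles t s0).
rewrite -nneseriesZl//; last first.
  by move=> n _; apply: integral_ge0 => z _; rewrite lee_fin rhoV_ge0.
by apply: lee_nneseries => [n _ _|n _]; [rewrite lee_fin sqr_ge0|case: (ha n)].
Qed.

(** Letting the side of the squares tend to 0 in the preceding bound also
    excludes, almost surely, points of multiplicity at least 2. *)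
Lemma separated_of_integrable :
  (\int[area]_z ((rho z ^+ 4)^-1)%:E < +oo)%E ->
  P [set w | separated_config (Lambda w)] = 1%E.
Proof.
move=> Ioo; set S := [set w | _].
have mS : measurable S by exact: measurable_separated.
have I0 : (0 <= \int[area]_z ((rho z ^+ 4)^-1)%:E)%E.
  by apply: integral_ge0 => z _; rewrite lee_fin rhoV_ge0.
set I := fine (\int[area]_z ((rho z ^+ 4)^-1)%:E)%E.
have IE : (\int[area]_z ((rho z ^+ 4)^-1)%:E = I%:E)%E.
  by rewrite fineK// ge0_fin_numE.
have I0' : 0 <= I by rewrite -lee_fin -IE.
pose N h b := \bigcup_n ~` atmost1 Lambda (tile (2 * h) (tile_offset h b) n).
have mN h b : measurable (N h b).
  apply: bigcupT_measurable => n; apply: measurableC.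
  by apply: (measurable_atmost1 hL); exact: measurable_tile.
have le_U A B x y : measurable A -> measurable B ->
    (P A <= x -> P B <= y -> P (A `|` B) <= x + y)%E.
  by move=> mA mB Ax By; apply: (@le_trans _ _ (P A + P B)%E);
    [exact: measureU2|exact: leeD].
have le_m m : (P (~` S) <= (4 * ((2 * m.+1%:R^-1) ^+ 2 * I))%:E)%E.
  set h : R := m.+1%:R^-1; have h0 : 0 < h by rewrite invr_gt0.
  have le_N b : (P (N h b) <= ((2 * h) ^+ 2 * I)%:E)%E.
    by rewrite EFinM -IE; apply: not_atmost1_tile_le => //; rewrite mulr_gt0.
  pose U := N h (false, false) `|` (N h (false, true) `|`
            (N h (true, false) `|` N h (true, true))).
  have mU : measurable U by do ! apply: measurableU.
  apply: (@le_trans _ _ (P U)).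
    apply: le_measure; rewrite ?inE//; first exact: measurableC.
    move=> w nS; apply: contrapT => nU; apply: nS; rewrite /S separatedE.
    exists m => // b n; apply: contrapT => gt1; apply: nU.
    have Nb : N h b w by exists n.
    by case: b Nb {gt1} => [[] []] Nb; [do 3 right|do 2 right; left|right; left|left].
  have -> : 4 * ((2 * h) ^+ 2 * I) = (2 * h) ^+ 2 * I + ((2 * h) ^+ 2 * I +
      ((2 * h) ^+ 2 * I + (2 * h) ^+ 2 * I)) by ring.
  rewrite !EFinD.
  by do ! [apply: (le_U) => //; try by do ! apply: measurableU].
have mCS : measurable (~` S) by exact: measurableC.
suff PCS0 : P (~` S) = 0%E.
  by rewrite -[S]setCK probability_setC// PCS0 sube0.
have finP := fin_num_measure P _ mCS.
rewrite -(fineK finP); congr (_%:E); apply/eqP; rewrite eq_le fine_ge0// andbT.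
rewrite leNgt; apply/negP; set p := fine _ => p0.
pose m := Num.bound (16 * I / p).
have : p <= 4 * ((2 * m.+1%:R^-1) ^+ 2 * I) by rewrite -lee_fin fineK.
have m1 : 16 * I < p * m.+1%:R.
  have Ip0 : 0 <= 16 * I / p by rewrite divr_ge0 ?mulr_ge0// ltW.
  rewrite (mulrC p) -ltr_pdivrMr//; apply: lt_trans (archi_boundP Ip0) _.
  by rewrite ltr_nat.
have mp : 1 <= m.+1%:R :> R by rewrite ler1n.
have -> : 4 * ((2 * m.+1%:R^-1) ^+ 2 * I) = 16 * I / m.+1%:R / m.+1%:R.
  by field; rewrite gt_eqF.
have m0 : 0 < m.+1%:R :> R by rewrite ltr0n.
rewrite !ler_pdivlMr// => pm.
have pm_ge : p * m.+1%:R <= p * m.+1%:R * m.+1%:R.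
  by rewrite ler_peMr// mulr_ge0 ?ltW.
by have := lt_le_trans m1 (le_trans pm_ge pm); rewrite ltxx.
Qed.

(** The comparison of intensities opposite to Cauchy-Schwarz. If rho exceeds
    4 s somewhere on the square, the Lipschitz bound makes rho constant there up
    to a factor 3, and then b is at most a constant times a ^ 2 with a <= 1 / 4.
    Otherwise rho <= 4 s on the whole square, which forces a >= 1 / 16. In both
    cases poisson_gt1 a >= (a / (a + 2)) ^ 2 concludes. *)
Lemma tile_dichotomy (s : R) t : 0 < s ->
  exists2 K : R, 0 <= K & forall n, exists a b,
    [/\ sigma rho (tile s t n) = a%:E, 0 <= a,
    (\int[area]_(z in tile s t n) ((rho z ^+ 4)^-1)%:E)%E = b%:E, 0 <= b &
    b <= K * poisson_gt1 a \/ 33^-1 ^+ 2 <= poisson_gt1 a].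
Proof.
move=> s0.
have K0 : 0 <= 729 / s ^+ 2.
  by apply: divr_ge0; [exact: ler0n|exact: sqr_ge0].
exists (729 / s ^+ 2) => [|n]; first exact: K0.
have [T0|areaT] := area_tile s0 t n.
  rewrite T0; exists 0, 0; rewrite /sigma !integral_set0; split=> //; left.
  exact: mulr_ge0 K0 (poisson_gt1_ge0 (lexx 0)).
have mT := measurable_tile s t n.
have bounds k lo hi : 0 < lo -> lo <= hi ->
    (forall z, tile s t n z -> lo <= rho z <= hi) ->
    exists2 a, (\int[area]_(z in tile s t n) ((rho z ^+ k)^-1)%:E = a%:E)%E &
      (hi ^+ k)^-1 * s ^+ 2 <= a <= (lo ^+ k)^-1 * s ^+ 2.
  move=> lo0 lohi h; have hi0 : 0 < hi by exact: lt_le_trans lo0 lohi.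
  apply: (integral_between mT _ _ areaT) => //.
  - exact: measurable_funTS (mrhoV k).
  - by rewrite invr_ge0 exprn_ge0// ltW.
  - move=> z /h /andP[hz _]; rewrite lef_pV2 ?posrE ?exprn_gt0//.
    by rewrite lerXn2r// nnegrE ltW.
  - move=> z /h /andP[_ hz]; rewrite lef_pV2 ?posrE ?exprn_gt0//.
    by rewrite lerXn2r// nnegrE ltW.
  - by rewrite invr_ge0 exprn_ge0// ltW.
have [[z0 [Tz0 rz0]]|small] := pselect (exists z0, tile s t n z0 /\ 4 * s < rho z0).
  set r := rho z0 in rz0.
  have comparable z : tile s t n z -> r / 2 <= rho z <= 3 * r / 2.
    move=> Tz; have := tile_diam Tz0 Tz.
    have := rho_lip z0 z; have := rho_lip z z0; rewrite (eucl_distC z) -/r.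
    by move=> h1 h2 h3; apply/andP; split; lra.
  have r0 : 0 < r by exact: rho_gt0.
  have r20 : 0 < r / 2 by lra.
  have rr : r / 2 <= 3 * r / 2 by lra.
  have [a aE /andP[a1 a2]] := bounds 2%N _ _ r20 rr comparable.
  have [b bE /andP[b1 b2]] := bounds 4%N _ _ r20 rr comparable.
  have aL : 4 / 9 * (s / r) ^+ 2 <= a.
    by apply: le_trans a1; rewrite le_eqVlt; apply/orP; left; apply/eqP; field; lra.
  have aU : a <= 4 * (s / r) ^+ 2.
    by apply: le_trans a2 _; rewrite le_eqVlt; apply/orP; left; apply/eqP; field; lra.
  have bU : b <= 16 / s ^+ 2 * (s / r) ^+ 4.
    apply: le_trans b2 _; rewrite le_eqVlt; apply/orP; left; apply/eqP; field.
    by apply/andP; split; lra.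
  have v0 : 0 <= s / r by rewrite divr_ge0 // ltW.
  have vU : s / r <= 1 / 4 by rewrite ler_pdivrMr//; lra.
  move: (s / r) aL aU bU v0 vU => v aL aU bU v0 vU.
  have a0 : 0 <= a by apply: le_trans aL; rewrite mulr_ge0// sqr_ge0.
  have a14 : a <= 1 / 4 by nra.
  have b0 : 0 <= b.
    by apply: le_trans b1; rewrite mulr_ge0// ?sqr_ge0// invr_ge0 exprn_ge0// ltW//; lra.
  exists a, b; split=> //; left; apply: le_trans bU _.
  (* 729 = 16 / (4 / 9 / 3) ^ 2, as a >= 4 / 9 * v ^ 2 and a + 2 <= 3 *)
  have -> : 16 / s ^+ 2 * v ^+ 4 = 729 / s ^+ 2 * ((4 / 9 * v ^+ 2) / 3) ^+ 2.
    by field; lra.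
  apply: ler_wpM2l => [|]; first exact: K0.
  apply: le_trans (poisson_gt1_ge a0); rewrite lerXn2r ?nnegrE//.
  - by rewrite divr_ge0// mulr_ge0// sqr_ge0.
  - by rewrite divr_ge0// addr_ge0.
  - by rewrite ler_pdivlMr ?ltr_wpDl//; nra.
have [x1 [x2 [y1 [y2 [x12 y12 box]]]]] := tile_bounded s0 t n.
have [l l0 hl] := lipschitz_box_lbound rho_gt0 rho_lip x12 y12.
have s40 : 0 < 4 * s by lra.
have lo0 : 0 < Num.min l (4 * s) by rewrite lt_min l0.
have lo4 : Num.min l (4 * s) <= 4 * s by rewrite ge_min lexx orbT.
have between z : tile s t n z -> Num.min l (4 * s) <= rho z <= 4 * s.
  move=> Tz; have [z1 z2] := box z Tz; apply/andP; split.
    by rewrite ge_min hl.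
  by rewrite leNgt; apply/negP => zs; apply: small; exists z.
have [a aE /andP[a1 _]] := bounds 2%N _ _ lo0 lo4 between.
have [b bE /andP[b1 _]] := bounds 4%N _ _ lo0 lo4 between.
have a16 : 1 / 16 <= a.
  by apply: le_trans a1; rewrite le_eqVlt; apply/orP; left; apply/eqP; field; lra.
have a0 : 0 <= a by lra.
have b0 : 0 <= b.
  by apply: le_trans b1; rewrite mulr_ge0// ?sqr_ge0// invr_ge0 exprn_ge0// ltW.
exists a, b; split=> //; right.
apply: le_trans (poisson_gt1_ge a0); rewrite lerXn2r ?nnegrE//.
  by rewrite divr_ge0// addr_ge0.
by rewrite ler_pdivlMr ?ltr_wpDl//; lra.
Qed.

(** Were all squares of one grid to carry at most one point each with positive
    probability, the numbers poisson_gt1 (a n) would be summable; all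
    but finitely many squares would then be of the first kind in
    tile_dichotomy, which makes the integral of rho ^ -4 finite. *)
Lemma not_separated_of_not_integrable :
  (\int[area]_z ((rho z ^+ 4)^-1)%:E = +oo)%E ->
  P [set w | separated_config (Lambda w)] = 0%E.
Proof.
move=> Ioo.
have tile0 (s : R) t : 0 < s -> P (\bigcap_n atmost1 Lambda (tile s t n)) = 0%E.
  move=> s0; apply/eqP; rewrite -measure_le0 leNgt; apply/negP => P0.
  have [K K0 /choice[a /choice[b hab]]] := tile_dichotomy t s0.
  have qoo : (\sum_(n <oo) (poisson_gt1 (a n))%:E < +oo)%E.
    apply: (summable_of_bigcap_atmost1 hL _ _ _ _ P0) => [n|||n].
    - exact: measurable_tile.
    - exact: trivIset_tile.
    - by move=> n; case: (hab n).
    - by case: (hab n).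
  have q0 n : 0 <= poisson_gt1 (a n) by apply: poisson_gt1_ge0; case: (hab n).
  have : poisson_gt1 (a n) @[n --> \oo] --> 0.
    by apply: cvg_series_cvg_0; exact: nnseries_is_cvg.
  move=> /cvgr0_norm_lt /(_ (33^-1 ^+ 2)) [|N _ hN]; first by rewrite exprn_gt0.
  move: Ioo; rewrite (integral_tiles t s0).
  rewrite (eq_eseriesr (g := fun n => (b n)%:E)); last by move=> n _; case: (hab n).
  (* finitely many squares contribute a finite sum; beyond N, hN leaves only
     the first kind *)
  apply/eqP; rewrite lt_eqF// (nneseries_split 0 N) ?add0n; last first.
    by move=> k _; rewrite lee_fin; case: (hab k).
  rewrite sumEFin; apply: lte_add_pinfty; first by rewrite ltry.
  rewrite -nneseries_addn; last by move=> k; rewrite lee_fin; case: (hab k).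
  apply: (@le_lt_trans _ _ (K%:E *
      \sum_(k <oo) (poisson_gt1 (a (k + N)%N))%:E)%E).
    rewrite -nneseriesZl => [|k _]; last by rewrite lee_fin.
    apply: lee_nneseries => [k _ _|k _]; first by rewrite lee_fin; case: (hab (k + N)%N).
    rewrite -EFinM lee_fin; have [_ _ _ _ [//|]] := hab (k + N)%N.
    have := hN _ (leq_addl k N); rewrite /= ger0_norm// => lt_q le_q.
    by move: (lt_le_trans lt_q le_q); rewrite ltxx.
  apply: lte_mul_pinfty; rewrite ?lee_fin//.
  rewrite (nneseries_addn (f := fun k => (poisson_gt1 (a k))%:E)); last first.
    by move=> k; rewrite lee_fin.
  apply: le_lt_trans qoo; rewrite (nneseries_split 0 N) ?add0n; last first.
    by move=> k _; rewrite lee_fin.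
  by rewrite leeDr// sume_ge0// => k _; rewrite lee_fin.
apply/eqP; rewrite -measure_le0.
rewrite separatedE.
apply: (@le_trans _ _ (\sum_(m <oo) P (sparse m.+1%:R^-1))%E).
  by apply: measure_sigma_subadditive => //; exact: bigcupT_measurable.
rewrite eseries0// => m _ _; apply/eqP; rewrite -measure_le0.
rewrite -(tile0 (2 * m.+1%:R^-1) (tile_offset m.+1%:R^-1 (false, false))); last first.
  by rewrite mulr_gt0// invr_gt0.
apply: le_measure; rewrite ?inE//.
  apply: bigcapT_measurable => n; apply: (measurable_atmost1 hL).
  exact: measurable_tile.
by move=> w; rewrite sparseE => /(_ (false, false) I).
Qed.

End separation.

(** * Poisson processes of doubling weights *)

Theorem theorem2p5 (R : realType) (d : measure_display)
    (Omega : measurableType d) (P : probability Omega R)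
    (phi : plane R -> \bar R) (nu : {measure set (plane R) -> \bar R})
    (rho : plane R -> R) (Lambda : Omega -> config R)
    (hphi : doubling_weight phi nu) (hrho : radius_function nu rho)
    (hLambda : poisson_process P (sigma rho) Lambda) :
  [/\ measurable [set w | separated_config (Lambda w)],
      (\int[area]_z ((rho z ^+ 4)^-1)%:E < +oo)%E ->
        P [set w | separated_config (Lambda w)] = 1%E &
      (\int[area]_z ((rho z ^+ 4)^-1)%:E = +oo)%E ->
        P [set w | separated_config (Lambda w)] = 0%E].
Proof.
have [_ _ nu0 dnu] := hphi.
have rho_gt0 z : 0 < rho z by case: (hrho z).
have rho_lip := radius_function_lipschitz nu0 dnu hrho.
split.
- exact: measurable_separated hLambda.
- exact: separated_of_integrable rho_gt0 rho_lip hLambda.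
- exact: not_separated_of_not_integrable rho_gt0 rho_lip hLambda.
Qed.
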